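(* Let $\mathfrak D$ be the complex mirror Heisenberg-Virasoro algebra. Any commutative post-Lie algebra structure on $\mathfrak D$ is trivial; that is, if $(x,y)\mapsto x\cdot y$ is a commutative post-Lie algebra structure on $\mathfrak D$, then $x\cdot y=0$ for all $x,y\in\mathfrak D$.
   Context: The mirror Heisenberg-Virasoro algebra $\mathfrak D$ is the complex Lie algebra with basis $\{d_m,\ h_r,\ \mathbf c,\ \mathbf l\mid m\in\mathbb Z,\ r\in\frac12+\mathbb Z\}$ and brackets (those not determined by the following and skew-symmetry are zero) $$[d_m,d_n]=(m-n)d_{m+n}+\tfrac{m^3-m}{12}\delta_{m+n,0}\,\mathbf c,\quad [d_m,h_r]=-r\,h_{m+r},\quad [h_r,h_s]=r\,\delta_{r+s,0}\,\mathbf l,$$ for $m,n\in\mathbb Z$, $r,s\in\frac12+\mathbb Z$. A commutative post-Lie algebra structure on a Lie algebra $(\mathfrak L,[\cdot,\cdot])$ is a bilinear product $x\cdot y$ on $\mathfrak L$ such that for all $x,y,z\in\mathfrak L$: $x\cdot y=y\cdot x$; $[x,y]\cdot z=x\cdot(y\cdot z)-y\cdot(x\cdot z)$; and $x\cdot[y,z]=[x\cdot y,z]+[y,x\cdot z]$. *)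

(* Defs.v *)
From HB Require Import structures.
From mathcomp Require Import all_boot all_order all_algebra.
From mathcomp Require Export finmap.
From mathcomp Require Export reals complex monalg.
From mathcomp Require Export sesquilinear.
From mathcomp Require Import ring.

Set Implicit Arguments.
Unset Strict Implicit.
Unset Printing Implicit Defensive.

Import GRing.Theory Num.Theory.
Local Open Scope ring_scope.

Section LieAlgebras.
Variables (F : fieldType) (L : lmodType F).

Record is_lie_bracket (br : L -> L -> L) : Prop := IsLieBracket {
  lie_bilinear : bilinear_for *:%R *:%R br;
  lie_alternating : forall x, br x x = 0;
  lie_jacobi : forall x y z,
    br x (br y z) + br y (br z x) + br z (br x y) = 0
}.

Record is_comm_post_lie (br dot : L -> L -> L) : Prop := IsCommPostLie {
  post_lie_bilinear : bilinear_for *:%R *:%R dot;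
  post_lie_comm : forall x y, dot x y = dot y x;
  post_lie_bracketl : forall x y z,
    dot (br x y) z = dot x (dot y z) - dot y (dot x z);
  post_lie_bracketr : forall x y z,
    dot x (br y z) = br (dot x y) z + br y (dot x z)
}.

End LieAlgebras.

(* [Bh k] is the index of h_(k + 1/2), so that the half-integers
   1/2 + Z are indexed by [k : int]. *)
Inductive mhv_index : Type := Bd of int | Bh of int | Bc | Bl.

Definition mhv_index_code (i : mhv_index) : int + int + bool :=
  match i with
  | Bd m => inl (inl m)
  | Bh k => inl (inr k)
  | Bc => inr true
  | Bl => inr false
  end.

Definition mhv_index_decode (x : int + int + bool) : mhv_index :=
  match x with
  | inl (inl m) => Bd m
  | inl (inr k) => Bh k
  | inr true => Bc
  | inr false => Bl
  end.

Lemma mhv_index_codeK : cancel mhv_index_code mhv_index_decode.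
Proof. by case. Qed.

HB.instance Definition _ := Choice.copy mhv_index (can_type mhv_index_codeK).

(* Finitely supported functions [mhv_index -> F]: the [F]-vector space with
   basis [<< i >>], [i : mhv_index]. The complex Lie algebra is [mhv R[i]] for
   [R : realType]; the base field is left abstract because [R[i]] is concrete
   enough to make unification of its structures very slow. *)
Notation mhv F := {malg F[mhv_index]}.

Section MirrorHeisenbergVirasoro.
Variable F : numFieldType.

Definition half_int (k : int) : F := k%:~R + 2^-1.

Definition mhv_basis_bracket (i j : mhv_index) : mhv F :=
  match i, j with
  | Bd m, Bd n =>
      (m - n)%:~R *: << Bd (m + n) >>
      + ((m ^+ 3 - m)%:~R / 12 * (m + n == 0)%:R) *: << Bc >>
  | Bd m, Bh r => - half_int r *: << Bh (m + r) >>
  | Bh r, Bd m => half_int r *: << Bh (m + r) >>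
  | Bh r, Bh s => (half_int r * (half_int r + half_int s == 0)%:R) *: << Bl >>
  | _, _ => 0
  end.

Definition mhv_bracket (x y : mhv F) : mhv F :=
  \sum_(i <- msupp x) \sum_(j <- msupp y)
    (x@_i * y@_j) *: mhv_basis_bracket i j.

Lemma mhv_bracketEw (A B : {fset mhv_index}) (x y : mhv F) :
  (msupp x `<=` A)%fset -> (msupp y `<=` B)%fset ->
  mhv_bracket x y =
    \sum_(i <- A) \sum_(j <- B) (x@_i * y@_j) *: mhv_basis_bracket i j.
Proof.
move=> sxA syB; rewrite /mhv_bracket (big_fset_incl _ sxA) /=; last first.
  move=> i _ /mcoeff_outdom xi0; rewrite big1 // => j _.
  by rewrite xi0 mul0r scale0r.
apply: eq_bigr => i _; rewrite (big_fset_incl _ syB) // => j _ /mcoeff_outdom.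
by move=> ->; rewrite mulr0 scale0r.
Qed.

Lemma mhv_bracketU i j : mhv_bracket << i >> << j >> = mhv_basis_bracket i j.
Proof.
rewrite (mhv_bracketEw msuppU_le msuppU_le) !big_seq_fset1.
by rewrite !mcoeffUU mulr1 scale1r.
Qed.

Lemma mhv_bracket_bilinear : bilinear_for *:%R *:%R mhv_bracket.
Proof.
split=> [y a u v|y a u v].
- pose A := (msupp (a *: u + v) `|` msupp u `|` msupp v)%fset.
  have [sA sB sC] : [/\ msupp (a *: u + v) `<=` A, msupp u `<=` A
    & msupp v `<=` A]%fset.
    by split; apply/fsubsetP => i; rewrite /A !inE => ->; rewrite ?orbT.
  rewrite /= (mhv_bracketEw sA (fsubset_refl _)).
  rewrite (mhv_bracketEw sB (fsubset_refl (msupp y))).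
  rewrite (mhv_bracketEw sC (fsubset_refl (msupp y))).
  rewrite scaler_sumr -big_split; apply: eq_bigr => i _ /=.
  rewrite scaler_sumr -big_split; apply: eq_bigr => j _ /=.
  by rewrite mcoeffD mcoeffZ scalerA -scalerDl mulrDl mulrA.
- pose A := (msupp (a *: u + v) `|` msupp u `|` msupp v)%fset.
  have [sA sB sC] : [/\ msupp (a *: u + v) `<=` A, msupp u `<=` A
    & msupp v `<=` A]%fset.
    by split; apply/fsubsetP => i; rewrite /A !inE => ->; rewrite ?orbT.
  rewrite /= (mhv_bracketEw (fsubset_refl (msupp y)) sA).
  rewrite (mhv_bracketEw (fsubset_refl (msupp y)) sB).
  rewrite (mhv_bracketEw (fsubset_refl (msupp y)) sC).
  rewrite scaler_sumr -big_split; apply: eq_bigr => i _ /=.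
  rewrite scaler_sumr -big_split; apply: eq_bigr => j _ /=.
  by rewrite mcoeffD mcoeffZ scalerA -scalerDl mulrDr mulrCA.
Qed.

HB.instance Definition _ := bilinear_isBilinear.Build F (mhv F) (mhv F)
  (mhv F) *:%R *:%R mhv_bracket mhv_bracket_bilinear.

Lemma mhv_linear_ext (f : mhv F -> mhv F) : linear f ->
  (forall i, f << i >> = 0) -> forall x, f x = 0.
Proof.
move=> lf f0 x.
pose lfB := GRing.isLinear.Build F (mhv F) (mhv F) *:%R f lf.
pose g : {linear mhv F -> mhv F} := HB.pack f lfB.
rewrite -[f]/(g : _ -> _) [x]monalgE linear_sum big1 // => i _.
have -> : << x@_i *g i >> = x@_i *: << i >> :> mhv F.
  by apply/malgP => k; rewrite mcoeffZ !mcoeffU mulrnAr mulr1.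
by rewrite linearZ /= f0 scaler0.
Qed.

Lemma half_int_eq0 r s :
  (half_int r + half_int s == 0) = (r + s + 1 == 0).
Proof.
rewrite -(intr_eq0 F); congr (_ == 0).
by rewrite /half_int !intrD; field.
Qed.

Lemma mhv_basis_bracketC i j :
  mhv_basis_bracket i j = - mhv_basis_bracket j i.
Proof.
have oppZ (a b : F) (u : mhv F) : a = - b -> a *: u = - (b *: u).
  by move=> ->; exact: scaleNr.
have oppZD (a b c d : F) (u v : mhv F) : a = - c -> b = - d ->
    a *: u + b *: v = - (c *: u + d *: v).
  by move=> ac bd; rewrite (oppZ a c) // (oppZ b d) // -opprD.
case: i j => [m|r||] [n|s||]; rewrite /mhv_basis_bracket ?oppr0 //.
- rewrite (addrC n m); apply: oppZD; first by rewrite -intrN opprB.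
  have [/eqP|] := eqVneq (m + n) 0; last by rewrite !mulr0 oppr0.
  rewrite addr_eq0 => /eqP ->; rewrite -!mulNr -intrN.
  by congr (_%:~R / _ * _); ring.
- exact: oppZ.
- by apply: oppZ; rewrite opprK.
apply: oppZ; rewrite [half_int s + _]addrC.
have [/eqP|] := eqVneq (half_int r + half_int s) 0; last by rewrite !mulr0 oppr0.
by rewrite addr_eq0 => /eqP ->; rewrite !mulNr.
Qed.

Lemma mhv_bracketC x y : mhv_bracket x y = - mhv_bracket y x.
Proof.
apply/eqP; rewrite -addr_eq0; apply/eqP; move: x.
apply: mhv_linear_ext => [a u v|i].
  by rewrite linearPl linearPr /= scalerDr addrACA.
move: y; apply: mhv_linear_ext => [a u v|j].
  by rewrite linearPl linearPr /= scalerDr addrACA.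
by rewrite !mhv_bracketU mhv_basis_bracketC addNr.
Qed.

#[local] Opaque mhv_bracket.

Let rot3 (a b c : mhv F) : a + b + c = b + c + a.
Proof. by rewrite -addrA; exact: addrC. Qed.

Let add3 (a a' b b' c c' : mhv F) :
  a + a' + (b + b') + (c + c') = a + b + c + (a' + b' + c').
Proof. by rewrite (addrACA a) (addrACA (a + b)). Qed.

Let J x y z := mhv_bracket x (mhv_bracket y z)
  + mhv_bracket y (mhv_bracket z x) + mhv_bracket z (mhv_bracket x y).

Let JC x y z : J x y z = J y z x.
Proof. exact: rot3. Qed.

Let JP a u v y z : J (a *: u + v) y z = a *: J u y z + J v y z.
Proof. by rewrite /J !(linearPl, linearPr) /= !scalerDr; exact: add3. Qed.

Let brZ i j a :
  mhv_bracket << i >> (a *: << j >>) = a *: mhv_basis_bracket i j.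
Proof. by rewrite linearZr_LR /= mhv_bracketU. Qed.

Let brD i j k a b : mhv_bracket << i >> (a *: << j >> + b *: << k >>) =
  a *: mhv_basis_bracket i j + b *: mhv_basis_bracket i k.
Proof. by rewrite linearPr /= brZ mhv_bracketU. Qed.

Let brDd m n a b :
  mhv_bracket << Bd m >> (a *: << Bd n >> + b *: << Bc >>) =
    (a * (m - n)%:~R) *: << Bd (m + n) >>
    + (a * ((m ^+ 3 - m)%:~R / 12 * (m + n == 0)%:R)) *: << Bc >>.
Proof. by rewrite brD /mhv_basis_bracket scaler0 addr0 scalerDr 2!scalerA. Qed.

Let brDh m r a : mhv_bracket << Bd m >> (a *: << Bh r >>) =
  (a * - half_int r) *: << Bh (m + r) >>.
Proof. by rewrite brZ /mhv_basis_bracket scalerA. Qed.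

Let brHd m r a b : mhv_bracket << Bh r >> (a *: << Bd m >> + b *: << Bc >>) =
  (a * half_int r) *: << Bh (m + r) >>.
Proof. by rewrite brD /mhv_basis_bracket [b *: _]scaler0 addr0 scalerA. Qed.

Let brHh r s a : mhv_bracket << Bh r >> (a *: << Bh s >>) =
  (a * (half_int r * (r + s + 1 == 0)%:R)) *: << Bl >>.
Proof. by rewrite brZ /mhv_basis_bracket scalerA half_int_eq0. Qed.

Let brL i a : mhv_bracket << i >> (a *: << Bl >>) = 0.
Proof. by rewrite brZ; case: i => *; exact: scaler0. Qed.

Let witt_jacobi (m n p : int) : (n - p)%:~R * (m - (n + p))%:~R
  + (p - m)%:~R * (n - (p + m))%:~R + (m - n)%:~R * (p - (m + n))%:~R = 0 :> F.
Proof. by rewrite !(rmorphB, rmorphD) /=; ring. Qed.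

Let virasoro_cocycle (m n p : int) (b : bool) : b = (m + (n + p) == 0) ->
  (n - p)%:~R * ((m ^+ 3 - m)%:~R / 12 * b%:R)
  + (p - m)%:~R * ((n ^+ 3 - n)%:~R / 12 * b%:R)
  + (m - n)%:~R * ((p ^+ 3 - p)%:~R / 12 * b%:R) = 0 :> F.
Proof.
move=> ->; have [S0|] := eqVneq (m + (n + p)) 0; last by rewrite !mulr0 !addr0.
have -> : m = - (n + p) by apply/eqP; rewrite -addr_eq0 S0.
by rewrite !(rmorphB, rmorphXn, rmorphN, rmorphD) /=; ring.
Qed.

Let sumZ2 (a b : F) (u : mhv F) : a + b = 0 -> a *: u + b *: u = 0.
Proof. by rewrite -scalerDl => ->; rewrite scale0r. Qed.

Let sumZ3 (a b c : F) (u : mhv F) : a + b + c = 0 ->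
  a *: u + b *: u + c *: u = 0.
Proof. by rewrite -!scalerDl => ->; rewrite scale0r. Qed.

Let sumZD3 (a b c a' b' c' : F) (u v : mhv F) :
  a + b + c = 0 -> a' + b' + c' = 0 ->
  a *: u + a' *: v + (b *: u + b' *: v) + (c *: u + c' *: v) = 0.
Proof. by move=> e e'; rewrite add3 (sumZ3 u e) (sumZ3 v e') addr0. Qed.

Let JU i j k : J << i >> << j >> << k >> = 0.
Proof.
have centr (a : mhv_index) y : a = Bc \/ a = Bl -> mhv_bracket << a >> y = 0.
  move=> aP; move: y; apply: mhv_linear_ext => [a' u v|j'].
    by rewrite linearPr.
  by rewrite mhv_bracketU; case: aP => ->.
have Jcentr a y z : a = Bc \/ a = Bl -> J << a >> y z = 0.
  move=> aP; rewrite /J !(centr _ _ aP) [mhv_bracket z << a >>]mhv_bracketC.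
  by rewrite (centr _ _ aP) oppr0 !linear0r !addr0.
have ddd m n p : J << Bd m >> << Bd n >> << Bd p >> = 0.
  rewrite /J 3!mhv_bracketU /mhv_basis_bracket 3!brDd.
  have -> : n + (p + m) = m + (n + p) by ring.
  have -> : p + (m + n) = m + (n + p) by ring.
  by apply: sumZD3; [exact: witt_jacobi | exact: virasoro_cocycle].
have ddh m n r : J << Bd m >> << Bd n >> << Bh r >> = 0.
  rewrite /J 3!mhv_bracketU /mhv_basis_bracket 2!brDh brHd.
  have -> : n + (m + r) = m + (n + r) by ring.
  have -> : m + n + r = m + (n + r) by ring.
  by apply: sumZ3; rewrite /half_int !intrD mulrNz; ring.
have dhh m r s : J << Bd m >> << Bh r >> << Bh s >> = 0.
  rewrite /J 3!mhv_bracketU /mhv_basis_bracket brL 2!brHh add0r.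
  have -> : r + (m + s) + 1 = m + (r + s + 1) by ring.
  have -> : s + (m + r) + 1 = m + (r + s + 1) by ring.
  by apply: sumZ2; ring.
have hhh q r s : J << Bh q >> << Bh r >> << Bh s >> = 0.
  by rewrite /J 3!mhv_bracketU /mhv_basis_bracket 3!brL addr0 addr0.
have Jc x y : J << Bc >> x y = 0 by apply: Jcentr; left.
have Jl x y : J << Bl >> x y = 0 by apply: Jcentr; right.
have JC2 x y z : J x y z = J z x y by rewrite (JC z).
case: i => [m|q||]; [| | exact: Jc | exact: Jl].
- case: j => [n|r||]; [| | rewrite JC; exact: Jc | rewrite JC; exact: Jl].
  + case: k => [p|s||]; [| | rewrite JC2; exact: Jc | rewrite JC2; exact: Jl].
      exact: ddd.
    exact: ddh.
  + case: k => [p|s||]; [| | rewrite JC2; exact: Jc | rewrite JC2; exact: Jl].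
      rewrite JC2; exact: ddh.
    exact: dhh.
- case: j => [n|r||]; [| | rewrite JC; exact: Jc | rewrite JC; exact: Jl].
  + case: k => [p|s||]; [| | rewrite JC2; exact: Jc | rewrite JC2; exact: Jl].
      rewrite JC; exact: ddh.
    rewrite JC; exact: dhh.
  + case: k => [p|s||]; [| | rewrite JC2; exact: Jc | rewrite JC2; exact: Jl].
      rewrite JC2; exact: dhh.
    exact: hhh.
Qed.

Let oppr_eq_self0 (V : lmodType F) (u : V) : u = - u -> u = 0.
Proof.
move/eqP; rewrite -addr_eq0 -mulr2n -scaler_nat scaler_eq0 pnatr_eq0.
by move/eqP.
Qed.

Lemma mhv_bracket_lie : is_lie_bracket mhv_bracket.
Proof.
split=> [|x|x y z]; first exact: mhv_bracket_bilinear.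
  exact: oppr_eq_self0 (mhv_bracketC x x).
rewrite -/(J x y z); move: x; apply: mhv_linear_ext => [a u v|i].
  exact: JP.
rewrite JC; move: y; apply: mhv_linear_ext => [a u v|j].
  exact: JP.
rewrite JC; move: z; apply: mhv_linear_ext => [a u v|k].
  exact: JP.
by rewrite JC JU.
Qed.

End MirrorHeisenbergVirasoro.

(* Main.v *)
From HB Require Import structures.
Require Import Defs.
From mathcomp Require Import all_boot all_algebra.
From mathcomp Require Import ring zify.

Set Implicit Arguments.
Unset Strict Implicit.
Unset Printing Implicit Defensive.

Import GRing.Theory Num.Theory.
Local Open Scope ring_scope.

(** Modulo the centre, spanned by c and l, an element of the algebra is its
coefficients on the d_m and the h_r, so a product x . y is studied through these
coefficients ([central_coef] says that they all vanish). Each left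
multiplication is a derivation, and applying it to [y, d_0], where ad d_0 is
diagonal on the basis, ties the coefficients of every value E y of a
derivation E to those of E d_0 ([mcoeff_der_dd], [mcoeff_der_hd],
[mcoeff_der_dh], [mcoeff_der_hh]). The half-integral weights of the h_r never
meet the integral weights of the d_m, so E h_r has no d-coefficient.

Commutativity turns these relations into a rigid system. They first confine
d_0 . d_n to a multiple a_n of d_n, up to h-terms, and then comparing
d_m . d_n with d_n . d_m gives n a_m = - m a_n for m <> n. Three different
indices force a_n = 0, and it follows that no product has a d-coefficient
([mcoeff_dot_dd]). After that d_m . h_r is a multiple of h_r for every m, while
h_r . d_m is the translate by m of h_r . d_0; both can only hold if d_m . h_r is
central, and then so is h_r . h_q ([dot_hd_central], [dot_hh_central]).

What remains, d_m . d_n in the span of the h_r and the centre, is not excluded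
by commutativity and the derivation property: both hold, modulo the centre, for
d_m . d_n = sum_t b_t h_(t+m+n) with any finitely supported b. It is excluded by
the remaining axiom [x, y] . z = x . (y . z) - y . (x . z): for x, y, z among the
d_n its right-hand side is central ([dot_dd_central]).

Hence all products are central, so every left multiplication is a derivation
with central values. It kills all brackets, and the algebra is perfect
([linear_eq0_on_brackets]). *)

(** The basis vectors d_m and h_(r + 1/2) are sealed so that comparing two of
them stops at their indices instead of unfolding finitely supported
functions. *)
HB.lock Definition vir (F : numFieldType) (m : int) : mhv F := << Bd m >>.
HB.lock Definition heis (F : numFieldType) (r : int) : mhv F := << Bh r >>.

(** * Coefficients of brackets *)

Section Brackets.
Variable F : numFieldType.
Implicit Types (x y z : mhv F) (k m n r s : int).

Local Notation d := (vir F).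
Local Notation h := (heis F).

Lemma virE m : d m = << Bd m >>. Proof. by rewrite vir.unlock. Qed.

Lemma heisE r : h r = << Bh r >>. Proof. by rewrite heis.unlock. Qed.

(** The weights of the h_r never vanish: this is what makes ad d_0 invertible on
their span and separates their weights from those of the d_m. *)
Lemma half_int_neq0 r : half_int F r != 0.
Proof.
have -> : half_int F r = (r * 2 + 1)%:~R / 2.
  by rewrite /half_int intrD intrM; field.
by rewrite mulf_neq0 ?invr_eq0 ?pnatr_eq0 // intr_eq0; lia.
Qed.

(** Reduces a formula for one coefficient of a linear map to basis vectors. *)
Lemma mcoeff_linear_ext (f : mhv F -> mhv F) (k j : mhv_index) (a : F) :
  linear f -> (forall i, (f << i >>)@_k = a * (<< i >> : mhv F)@_j) ->
  forall x, (f x)@_k = a * x@_j.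
Proof.
move=> lf fB x; pose g y : mhv F := ((f y)@_k - a * y@_j) *: << k >>.
have lg : linear g.
  move=> b u v; rewrite /g lf !mcoeffD !mcoeffZ scalerA -scalerDl.
  by congr (_ *: _); ring.
have g0 i : g << i >> = 0 by rewrite /g fB subrr scale0r.
have /(congr1 (fun y : mhv F => y@_k)) := mhv_linear_ext lg g0 x.
by rewrite mcoeffZ mcoeffUU mulr1 mcoeff0 => /eqP; rewrite subr_eq0 => /eqP.
Qed.

(** Only the basis vectors in the support of [x] matter here, which lets a
product with an element without d-part be computed from the products with the
other basis vectors. *)
Lemma mcoeff_linear_eq0 (f : mhv F -> mhv F) (k : mhv_index) x :
  linear f -> (forall i, x@_i != 0 -> (f << i >>)@_k = 0) -> (f x)@_k = 0.
Proof.
move=> lf f0; pose lfB := GRing.isLinear.Build F (mhv F) (mhv F) *:%R f lf.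
pose g : {linear mhv F -> mhv F} := HB.pack f lfB.
rewrite -[f]/(g : _ -> _) [x]monalgE linear_sum /= raddf_sum big1_seq // => i.
rewrite -mcoeff_neq0 => /andP[_ /f0 fi0].
have -> : << x@_i *g i >> = x@_i *: << i >> :> mhv F.
  by apply/malgP => j; rewrite mcoeffZ !mcoeffU mulrnAr mulr1.
by rewrite (GRing.scalable_linear lf) /= mcoeffZ fi0 mulr0.
Qed.

Lemma eq_Bd m n : (Bd m == Bd n) = (m == n).
Proof. by apply/eqP/eqP => [[]|->]. Qed.

Lemma eq_Bh r s : (Bh r == Bh s) = (r == s).
Proof. by apply/eqP/eqP => [[]|->]. Qed.

Lemma bracketl_linear y : linear (fun x => mhv_bracket x y).
Proof. by move=> a u v; rewrite linearPl. Qed.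

Lemma mcoeff_bracket_dd n k x :
  (mhv_bracket x (d n))@_(Bd k) = (k - 2 * n)%:~R * x@_(Bd (k - n)).
Proof.
rewrite virE.
apply: (@mcoeff_linear_ext (fun x => mhv_bracket x _)).
  exact: bracketl_linear.
move=> i; rewrite mhv_bracketU mcoeffU; case: i => [m|r||] /=;
  rewrite ?mcoeffD ?mcoeffZ ?mcoeffU ?eq_Bd ?mulr0 ?addr0 ?mcoeff0 //.
have -> : (m == k - n) = (m + n == k) by lia.
by case: eqP => [<-|]; rewrite ?mulr0 //=; congr (_%:~R * _); ring.
Qed.

Lemma mcoeff_bracket_hd n s x :
  (mhv_bracket x (d n))@_(Bh s) = half_int F (s - n) * x@_(Bh (s - n)).
Proof.
rewrite virE.
apply: (@mcoeff_linear_ext (fun x => mhv_bracket x _)).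
  exact: bracketl_linear.
move=> i; rewrite mhv_bracketU mcoeffU; case: i => [m|r||] /=;
  rewrite ?mcoeffD ?mcoeffZ ?mcoeffU ?eq_Bh ?mulr0 ?addr0 ?mcoeff0 //.
have -> : (r == s - n) = (n + r == s) by lia.
by case: eqP => [<-|]; rewrite ?mulr0 //=; congr (half_int _ _ * _); ring.
Qed.

Lemma mcoeff_bracket_dh r k x : (mhv_bracket x (h r))@_(Bd k) = 0.
Proof.
rewrite -[RHS](mul0r (x@_Bc)) heisE.
apply: (@mcoeff_linear_ext (fun x => mhv_bracket x _)).
  exact: bracketl_linear.
move=> i; rewrite mhv_bracketU mul0r; case: i => [m|s||] /=;
  by rewrite ?mcoeffZ ?mcoeffU ?mulr0 ?mcoeff0.
Qed.

Lemma mcoeff_bracket_hh r s x :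
  (mhv_bracket x (h r))@_(Bh s) = - half_int F r * x@_(Bd (s - r)).
Proof.
rewrite heisE.
apply: (@mcoeff_linear_ext (fun x => mhv_bracket x _)).
  exact: bracketl_linear.
move=> i; rewrite mhv_bracketU mcoeffU; case: i => [m|q||] /=;
  rewrite ?mcoeffD ?mcoeffZ ?mcoeffU ?eq_Bd ?eq_Bh ?mulr0 ?addr0 ?mcoeff0 //.
by have -> : (m == s - r) = (m + r == s) by lia.
Qed.

(** Membership in the centre, which is spanned by c and l. *)
Definition central_coef x := forall k, x@_(Bd k) = 0 /\ x@_(Bh k) = 0.

Lemma bracket_central x y : central_coef x -> mhv_bracket x y = 0.
Proof.
move=> x0; rewrite /mhv_bracket big1 // => i _; rewrite big1 // => j _.
by case: i => [k|k||]; rewrite ?(x0 k).1 ?(x0 k).2 ?mul0r ?scale0r ?scaler0.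
Qed.

Lemma bracket_dd m n : mhv_bracket (d m) (d n) =
  (m - n)%:~R *: d (m + n)
    + ((m ^+ 3 - m)%:~R / 12 * (m + n == 0)%:R) *: << Bc >>.
Proof. by rewrite !virE mhv_bracketU. Qed.

Lemma bracket_d0 n : mhv_bracket (d n) (d 0) = n%:~R *: d n.
Proof.
rewrite bracket_dd subr0; case: eqP => [->|_]; last first.
  by rewrite mulr0 scale0r addr0.
by rewrite expr0n subrr !mul0r !scale0r addr0.
Qed.

Lemma bracket_h0 r : mhv_bracket (h r) (d 0) = half_int F r *: h r.
Proof. by rewrite virE heisE mhv_bracketU /= add0r. Qed.

Lemma bracket_dh m r : mhv_bracket (d m) (h r) = - half_int F r *: h (m + r).
Proof. by rewrite virE !heisE mhv_bracketU. Qed.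

Lemma scaleVK (a : F) (x : mhv F) y : a != 0 -> a *: x = y -> x = a^-1 *: y.
Proof. by move=> a0 <-; rewrite scalerA mulVf // scale1r. Qed.

(** The algebra is perfect: d_m for m <> 0 and h_r are multiples of brackets
with d_0, and d_0 is one of [d_1, d_-1]; then c is reached by [d_2, d_-2] and l
by [h_(1/2), h_(-1/2)]. *)
Lemma linear_eq0_on_brackets (f : mhv F -> mhv F) : linear f ->
  (forall x y, f (mhv_bracket x y) = 0) -> forall x, f x = 0.
Proof.
move=> lf fbr; pose lfB := GRing.isLinear.Build F (mhv F) (mhv F) *:%R f lf.
pose g : {linear mhv F -> mhv F} := HB.pack f lfB.
have gbr x y : g (mhv_bracket x y) = 0 by exact: fbr.
have gZ a x y z : a != 0 -> mhv_bracket x y = a *: z -> g z = 0.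
  by move=> a0 /esym /(scaleVK a0) ->; rewrite linearZ /= fbr scaler0.
have gd0 : g (d 0) = 0.
  apply: (gZ 2%:~R (d 1) (d (-1))); first by rewrite intr_eq0.
  by rewrite bracket_dd expr1n subrr !mul0r scale0r addr0.
apply: mhv_linear_ext => // -[m|r||].
- rewrite -virE; have [->|m0] := eqVneq m 0; first exact: gd0.
  by apply: (gZ m%:~R (d m) (d 0)); rewrite ?intr_eq0 ?bracket_d0.
- rewrite -heisE; apply: (gZ (half_int F r) _ (d 0) _ (half_int_neq0 r)).
  exact: bracket_h0.
- have := gbr (d 2) (d (-2)).
  rewrite bracket_dd linearD !linearZ /= (gd0 : f (d (2 - 2)) = 0).
  rewrite scaler0 add0r mulr1 => /eqP; rewrite scaler_eq0.
  have /negPf -> : (2 ^+ 3 - 2)%:~R / 12 != 0 :> F.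
    by rewrite mulf_neq0 ?invr_neq0 ?pnatr_eq0 ?intr_eq0.
  by move/eqP.
- apply: (gZ (half_int F 0) (h 0) (h (-1)) _ (half_int_neq0 0)).
  rewrite !heisE mhv_bracketU /= half_int_eq0.
  by rewrite mulr1.
Qed.

(** * Derivations modulo the centre *)

Section Derivation.
Variable E : mhv F -> mhv F.
Hypothesis E_linear : linear E.
Hypothesis E_der : forall y z,
  E (mhv_bracket y z) = mhv_bracket (E y) z + mhv_bracket y (E z).

Let EZ a x : E (a *: x) = a *: E x.
Proof. exact: GRing.scalable_linear E_linear a x. Qed.

Let Ed0 y : E (mhv_bracket y (d 0)) =
  mhv_bracket (E y) (d 0) - mhv_bracket (E (d 0)) y.
Proof. by rewrite E_der -mhv_bracketC. Qed.

(** This lemma and the next three compare, in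
E [y, d_0] = [E y, d_0] - [E d_0, y], the coefficients on one basis vector for y
of weight n under ad d_0. The left side multiplies by the weight of y and
the first term on the right by the weight of that basis vector. *)
Lemma mcoeff_der_dd n k : (k - n)%:~R * (E (d n))@_(Bd k) =
  (k - 2 * n)%:~R * (E (d 0))@_(Bd (k - n)).
Proof.
have /(congr1 (fun x : mhv F => x@_(Bd k))) := Ed0 (d n).
rewrite bracket_d0 EZ mcoeffZ mcoeffB !mcoeff_bracket_dd mulr0 !subr0.
move=> eq; have -> : (k - n)%:~R = k%:~R - n%:~R :> F by rewrite intrB.
by rewrite mulrBl eq; ring.
Qed.

(** The factor s - n + 1/2 on both sides cancels because it is never 0. *)
Lemma mcoeff_der_hd n s : (E (d n))@_(Bh s) = (E (d 0))@_(Bh (s - n)).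
Proof.
have /(congr1 (fun x : mhv F => x@_(Bh s))) := Ed0 (d n).
rewrite bracket_d0 EZ mcoeffZ mcoeffB !mcoeff_bracket_hd !subr0 => eq.
apply: (mulfI (half_int_neq0 (s - n))); apply/eqP; rewrite -subr_eq0.
apply/eqP; move: eq => /eqP; rewrite -subr_eq0 => /eqP eq.
by rewrite -[RHS]oppr0 -eq /half_int intrB; ring.
Qed.

Lemma mcoeff_der_dh r k : (E (h r))@_(Bd k) = 0.
Proof.
have /(congr1 (fun x : mhv F => x@_(Bd k))) := Ed0 (h r).
rewrite bracket_h0 EZ mcoeffZ mcoeffB mcoeff_bracket_dd mcoeff_bracket_dh.
rewrite mulr0 !subr0 => /eqP; rewrite -subr_eq0 -mulrBl mulf_eq0.
suff -> : half_int F r - k%:~R = half_int F (r - k).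
  by rewrite (negPf (half_int_neq0 _)) => /eqP.
by rewrite /half_int intrB; ring.
Qed.

Lemma mcoeff_der_hh r s : (s - r)%:~R * (E (h r))@_(Bh s) =
  - half_int F r * (E (d 0))@_(Bd (s - r)).
Proof.
have /(congr1 (fun x : mhv F => x@_(Bh s))) := Ed0 (h r).
rewrite bracket_h0 EZ mcoeffZ mcoeffB mcoeff_bracket_hd mcoeff_bracket_hh.
rewrite !subr0 => eq.
have -> : (s - r)%:~R = half_int F s - half_int F r.
  by rewrite /half_int intrB; ring.
by rewrite mulrBl eq; ring.
Qed.

(** On the diagonal k = n the left side of the relation between E d_n and E d_0
vanishes but its right side is - n times this coefficient. *)
Lemma mcoeff_der_d00 : (E (d 0))@_(Bd 0) = 0.
Proof.
have := mcoeff_der_dd 1 1; rewrite subrr mul0r => /esym/eqP.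
by rewrite mulf_eq0 intr_eq0 => /eqP.
Qed.

(** A derivation preserves the centre: if x commutes
with all y, then [E x, y] = E [x, y] - [x, E y] = 0. *)
Lemma der_central x : (forall y, mhv_bracket x y = 0) -> central_coef (E x).
Proof.
move=> x0.
have Ex0 y : mhv_bracket (E x) y = 0.
  have := E_der x y; rewrite !x0 addr0 => <-.
  by have := EZ 0 0; rewrite !scale0r.
have Ed k : (E x)@_(Bd k) = 0.
  (* The index k + 1 is any other than k, since d_k commutes with itself. *)
  have := mcoeff_bracket_dd (k + 1) (2 * k + 1) (E x).
  rewrite Ex0 mcoeff0 => /esym/eqP.
  have -> : 2 * k + 1 - 2 * (k + 1) = -1 by ring.
  have -> : 2 * k + 1 - (k + 1) = k by ring.
  by rewrite mulf_eq0 intr_eq0 => /eqP.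
move=> k; split=> //.
have := mcoeff_bracket_hd 0 k (E x); rewrite Ex0 mcoeff0 subr0 => /esym/eqP.
by rewrite mulf_eq0 (negPf (half_int_neq0 _)) => /eqP.
Qed.

End Derivation.

(** * The d-part of a commutative post-Lie product *)

Section PostLie.
Variable dot : mhv F -> mhv F -> mhv F.
Hypothesis dot_post_lie : is_comm_post_lie (@mhv_bracket F) dot.

Let dotC x y : dot x y = dot y x.
Proof. exact: post_lie_comm dot_post_lie x y. Qed.

Let dot_linear x : linear (dot x).
Proof. exact: (post_lie_bilinear dot_post_lie).2. Qed.

Let dotZ x a y : dot x (a *: y) = a *: dot x y.
Proof. exact: GRing.scalable_linear (dot_linear x) a y. Qed.

Let dot_der x y z : dot x (mhv_bracket y z) =
  mhv_bracket (dot x y) z + mhv_bracket y (dot x z).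
Proof. exact: post_lie_bracketr dot_post_lie x y z. Qed.

(** The value at d_0 of the derivation d_0 . _ has no d-part: for j <> 0,
its coefficient on d_j is a multiple of the d_0 coefficient of
d_0 . d_-j = d_-j . d_0, and the d_0 coefficient of E d_0 vanishes for every
derivation E. With the d-part of E d_0 zero, E multiplies each d_n by a scalar,
up to h-terms and the centre. *)
Lemma mcoeff_dot_d0_d_offdiag n k : k != n -> (dot (d 0) (d n))@_(Bd k) = 0.
Proof.
have dot_d0_d0 j : (dot (d 0) (d 0))@_(Bd j) = 0.
  have [->|j0] := eqVneq j 0.
    exact: mcoeff_der_d00 (dot_linear _) (dot_der _).
  have := mcoeff_der_dd (dot_linear (d 0)) (dot_der (d 0)) (- j) 0.
  rewrite dotC (mcoeff_der_d00 (dot_linear _) (dot_der _)) mulr0 => /esym/eqP.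
  have -> : 0 - - j = j by ring.
  have -> : 0 - 2 * - j = 2 * j by ring.
  by rewrite mulf_eq0 intr_eq0 mulf_eq0 (negPf j0) => /eqP.
move=> kn; have := mcoeff_der_dd (dot_linear (d 0)) (dot_der (d 0)) n k.
rewrite dot_d0_d0 mulr0 => /eqP.
by rewrite mulf_eq0 intr_eq0 subr_eq0 (negPf kn) => /eqP.
Qed.

Let alpha n := (dot (d 0) (d n))@_(Bd n).

(** The coefficient of d_m . d_n on d_(m+n) can be computed from the derivation
d_m . _ and from d_n . _; equating the results gives this relation after
division by m - n. *)
Let alphaP m n : m != n -> n%:~R * alpha m = - (m%:~R * alpha n).
Proof.
move=> mn.
have half p q : p%:~R * (dot (d p) (d q))@_(Bd (p + q)) =
    (p - q)%:~R * alpha p.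
  have := mcoeff_der_dd (dot_linear (d p)) (dot_der (d p)) q (p + q).
  have -> : p + q - 2 * q = p - q by ring.
  by rewrite addrK (dotC (d p) (d 0)).
have E1 := half m n; have E2 := half n m.
rewrite (dotC (d n)) (addrC n) in E2.
have mn0 : (m - n)%:~R != 0 :> F by rewrite intr_eq0 subr_eq0.
apply: (mulfI mn0); rewrite mulrCA -E1 mulrCA E2.
by rewrite !intrB; ring.
Qed.

(** The indices n, 2 n and 3 n already make the relations between the scalars
inconsistent unless they vanish. *)
Lemma mcoeff_dot_d0_d n k : (dot (d 0) (d n))@_(Bd k) = 0.
Proof.
have [->|] := eqVneq k n; last exact: mcoeff_dot_d0_d_offdiag.
have [->|n0] := eqVneq n 0.
  exact: mcoeff_der_d00 (dot_linear _) (dot_der _).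
have nF0 : n%:~R != 0 :> F by rewrite intr_eq0.
have P2 := @alphaP n (2 * n) ltac:(lia).
have P3 := @alphaP n (3 * n) ltac:(lia).
have P23 := @alphaP (2 * n) (3 * n) ltac:(lia).
rewrite -/(alpha n).
have : 12%:R * n%:~R * n%:~R * alpha n = 0.
  rewrite !intrM in P2 P3 P23.
  have e2 : alpha (2 * n) = - (2 * alpha n).
    by apply: (mulfI nF0); rewrite -[LHS]opprK -P2; ring.
  have e3 : alpha (3 * n) = - (3 * alpha n).
    by apply: (mulfI nF0); rewrite -[LHS]opprK -P3; ring.
  rewrite e2 e3 in P23.
  move/eqP: P23; rewrite -subr_eq0 => /eqP P23.
  by rewrite -[RHS](mulr0 (- n%:~R)) -P23; ring.
move/eqP; rewrite !mulf_eq0 pnatr_eq0 (negPf nF0) /=.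
by move/eqP.
Qed.

Lemma mcoeff_dot_dd_offdiag m n k : (m != k) || (n != k) ->
  (dot (d m) (d n))@_(Bd k) = 0.
Proof.
wlog nk : m n / n != k.
  move=> W /orP[mk|nk]; last by apply: W; rewrite ?nk ?orbT.
  by rewrite dotC; apply: W; rewrite ?mk ?orbT.
move=> _; have := mcoeff_der_dd (dot_linear (d m)) (dot_der (d m)) n k.
rewrite (dotC (d m) (d 0)) mcoeff_dot_d0_d mulr0 => /eqP.
by rewrite mulf_eq0 intr_eq0 subr_eq0 eq_sym (negPf nk) => /eqP.
Qed.

(** Only the coefficient of d_k . d_k on d_k is left. It is read off from
d_k . [d_(3k), d_(-2k)], where expanding by the derivation property gives only
off-diagonal products. *)
Lemma mcoeff_dot_dd m n k : (dot (d m) (d n))@_(Bd k) = 0.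
Proof.
have [->|mk] := eqVneq m k; last by apply: mcoeff_dot_dd_offdiag; rewrite mk.
have [->|nk] := eqVneq n k; last first.
  by apply: mcoeff_dot_dd_offdiag; rewrite nk orbT.
have [->|k0] := eqVneq k 0; first exact: mcoeff_dot_d0_d.
have := dot_der (d k) (d (3 * k)) (d (- 2 * k)).
move/(congr1 (fun x : mhv F => x@_(Bd k))).
rewrite [mhv_bracket (d (3 * k)) (dot _ _)]mhv_bracketC.
rewrite mcoeffD mcoeffN !mcoeff_bracket_dd.
rewrite (@mcoeff_dot_dd_offdiag k (3 * k)); last by lia.
rewrite (@mcoeff_dot_dd_offdiag k (- 2 * k)); last by lia.
rewrite !mulr0 subr0 bracket_dd.
have -> : 3 * k + - 2 * k = k by ring.
rewrite (negPf k0) mulr0 scale0r addr0.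
have -> : 3 * k - (- 2 * k) = 5 * k by ring.
rewrite dotZ mcoeffZ => /eqP; rewrite mulf_eq0 intr_eq0 mulf_eq0 (negPf k0).
by move/eqP.
Qed.

(** * The h-part of a commutative post-Lie product *)

(** As a derivation, d_n . _ maps h_r to a multiple of h_r modulo the centre, as
d_n . d_0 has no d-part. As a derivation, h_r . _ sends d_n to the translate by n
of the h-part of h_r . d_0. The two supports are incompatible for n <> 0, and n = 0
follows by translating by 1. *)
Lemma mcoeff_dot_hd r n s : (dot (h r) (d n))@_(Bh s) = 0.
Proof.
have dot_off m q t : t != q -> (dot (d m) (h q))@_(Bh t) = 0.
  move=> tq; have := mcoeff_der_hh (dot_linear (d m)) (dot_der (d m)) q t.
  rewrite mcoeff_dot_dd mulr0 => /eqP.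
  by rewrite mulf_eq0 intr_eq0 subr_eq0 (negPf tq) => /eqP.
have shift m q t := mcoeff_der_hd (dot_linear (h q)) (dot_der (h q)) m t.
have [->|sr] := eqVneq s r; last by rewrite dotC dot_off.
have [->|n0] := eqVneq n 0.
  have := shift 1 r (r + 1); rewrite addrK => <-.
  by rewrite dotC dot_off //; lia.
by rewrite shift dotC dot_off //; lia.
Qed.

Lemma dot_hd_central r n : central_coef (dot (h r) (d n)).
Proof.
move=> k; split; last exact: mcoeff_dot_hd.
by rewrite dotC (mcoeff_der_dh (dot_linear _) (dot_der _)).
Qed.

(** By commutativity h_r . h_q is supported on both h_q and h_r, so only
h_r . h_r can be nonzero modulo the centre; expanding
h_r . [d_1, h_(r-1)] gives only brackets with central elements. *)
Lemma dot_hh_central r q : central_coef (dot (h r) (h q)).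
Proof.
have hd x t k : (dot x (h t))@_(Bd k) = 0.
  by rewrite (mcoeff_der_dh (dot_linear _) (dot_der _)).
have off t t' s : s != t' -> (dot (h t) (h t'))@_(Bh s) = 0.
  move=> st; have := mcoeff_der_hh (dot_linear (h t)) (dot_der (h t)) t' s.
  rewrite (dotC (h t) (d 0)) hd mulr0 => /eqP.
  by rewrite mulf_eq0 intr_eq0 subr_eq0 (negPf st) => /eqP.
have offC t t' s : s != t -> (dot (h t) (h t'))@_(Bh s) = 0.
  by move=> st; rewrite dotC off.
move=> s; split; first exact: hd.
have [->|] := eqVneq s q; last exact: off.
have [<-|] := eqVneq r q; last by rewrite eq_sym; exact: offC.
have r_central : central_coef (dot (h r) (h (r - 1))).
  move=> k; split; first exact: hd.
  have [->|] := eqVneq k r; last exact: offC.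
  by apply: off; lia.
have := dot_der (h r) (d 1) (h (r - 1)).
rewrite (bracket_central _ (dot_hd_central _ _)).
rewrite [mhv_bracket _ (dot _ _)]mhv_bracketC.
rewrite (bracket_central _ r_central) oppr0 addr0 bracket_dh.
have -> : 1 + (r - 1) = r by ring.
rewrite dotZ => /(congr1 (fun x : mhv F => x@_(Bh r))) /eqP.
by rewrite mcoeffZ mcoeff0 mulf_eq0 oppr_eq0 (negPf (half_int_neq0 _)) => /eqP.
Qed.

Let dot_central_basis x y :
  (forall i, y@_i != 0 -> central_coef (dot x << i >>)) ->
  central_coef (dot x y).
Proof.
move=> xy k; split; apply: (mcoeff_linear_eq0 (dot_linear x)) => i yi;
  by have [] := xy i yi k.
Qed.

Let dot_center x i : i = Bc \/ i = Bl -> central_coef (dot x << i >>).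
Proof.
move=> iP; apply: (der_central (dot_linear x) (dot_der x)) => y.
by apply: bracket_central => k; case: iP => ->; rewrite !mcoeffU.
Qed.

Lemma dot_d_heis_central m z : (forall k, z@_(Bd k) = 0) ->
  central_coef (dot (d m) z).
Proof.
move=> zd; apply: dot_central_basis => -[k|r||].
- by rewrite zd eqxx.
- by move=> _; rewrite -heisE dotC; exact: dot_hd_central.
- by move=> _; apply: dot_center; left.
- by move=> _; apply: dot_center; right.
Qed.

(** The axiom for [d_p, d_0] . d_q, whose right-hand side is central because
d_0 . d_q and d_p . d_q have no d-part, settles p d_p . d_q. The h-part of
d_0 . d_0 is a translate of that of d_0 . d_1. *)
Lemma dot_dd_central m n : central_coef (dot (d m) (d n)).
Proof.
have dd_h p q s : p != 0 -> (dot (d p) (d q))@_(Bh s) = 0.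
  move=> p0.
  have dd_central u v w : central_coef (dot (d u) (dot (d v) (d w))).
    by apply: dot_d_heis_central; exact: mcoeff_dot_dd.
  have := post_lie_bracketl dot_post_lie (d p) (d 0) (d q).
  rewrite bracket_d0 dotC dotZ => /(congr1 (fun x : mhv F => x@_(Bh s))) /eqP.
  rewrite mcoeffZ mcoeffB !(dd_central _ _ _ s).2 subrr.
  by rewrite mulf_eq0 intr_eq0 (negPf p0) dotC => /eqP.
move=> s; split; first exact: mcoeff_dot_dd.
have [->|] := eqVneq m 0; last exact: dd_h.
have [->|] := eqVneq n 0; last by rewrite dotC; exact: dd_h.
have := mcoeff_der_hd (dot_linear (d 0)) (dot_der (d 0)) 1 (s + 1).
by rewrite addrK => <-; rewrite dotC dd_h.
Qed.

Lemma dot_central x y : central_coef (dot x y).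
Proof.
apply: dot_central_basis => j _; rewrite dotC.
apply: dot_central_basis => i _; rewrite dotC.
case: j => [n|r||].
- rewrite -virE; case: i => [m|q||].
  + by rewrite -virE; exact: dot_dd_central.
  + by rewrite -heisE; exact: dot_hd_central.
  + by rewrite dotC; apply: dot_center; left.
  + by rewrite dotC; apply: dot_center; right.
- rewrite -heisE; case: i => [m|q||].
  + by rewrite -virE dotC; exact: dot_hd_central.
  + by rewrite -heisE; exact: dot_hh_central.
  + by rewrite dotC; apply: dot_center; left.
  + by rewrite dotC; apply: dot_center; right.
- by apply: dot_center; left.
- by apply: dot_center; right.
Qed.

(** * Triviality *)

Lemma comm_post_lie_trivial x y : dot x y = 0.
Proof.
move: y; apply: linear_eq0_on_brackets (dot_linear x) _ => y z.
rewrite dot_der (bracket_central _ (dot_central _ _)) mhv_bracketC.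
by rewrite (bracket_central _ (dot_central _ _)) oppr0 addr0.
Qed.

End PostLie.
End Brackets.

Theorem theorem10 (R : realType) (dot : mhv R[i] -> mhv R[i] -> mhv R[i])
    (dot_post_lie : is_comm_post_lie (@mhv_bracket R[i]) dot)
    (x y : mhv R[i]) :
  dot x y = 0%R.
Proof. exact: comm_post_lie_trivial dot_post_lie x y. Qed.
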